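(* Let $r \geq 2$ be an integer and let $K, C > 0$ be real numbers. Let $A_1, \dots, A_r$ be finite nonempty subsets of an abelian group $\mathbf{G}$ and let $H \subseteq A_1 \times \cdots \times A_r$ be an $r$-partite $r$-uniform hypergraph with $\lvert E(H)\rvert \geq \frac{1}{K} \prod_{i\in [r]} \lvert A_i\rvert$ and $\left\lvert \bigoplus_H (A_1, \dots, A_r)\right\rvert \leq C\left(\prod_{i \in [r]} \lvert A_i\rvert \right)^{1/r}$. Then for each $i\in [r]$ there exists $A_i' \subseteq A_i$ such that (1) $\lvert A'_i\rvert \geq \frac{\lvert A_i\rvert}{2^{i+2} K}$ for each $i\in [r]$, and (2) $\lvert A_1' + \cdots + A_r'\rvert \leq 8^{r^3}(r-1)^{(r-1)}K^{(r^2 + 5r - 4)/2}C^{2r-1} \left(\prod_{i\in [r]} \lvert A_i\rvert \right)^{1/r}$.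
   Context: An $r$-partite $r$-uniform hypergraph $H \subseteq A_1\times\cdots\times A_r$ is a set $E(H)$ of ordered tuples $(a_1,\dots,a_r)$ with $a_i\in A_i$. For such $H$, $\bigoplus_H (A_1, \dots, A_r) \coloneqq \{\sum_{i\in [r]} a_i : (a_1, \dots, a_r) \in E(H)\}$. $A_1'+\cdots+A_r'$ denotes the sumset $\{a_1+\cdots+a_r : a_i\in A_i'\}$. *)

(* Defs.v *)
From mathcomp Require Export all_boot all_order all_algebra.
From mathcomp Require Export finmap reals exp.
Export GRing.Theory Num.Theory.

Set Implicit Arguments.
Unset Strict Implicit.
Unset Printing Implicit Defensive.

Local Open Scope fset_scope.
Local Open Scope ring_scope.

Section PartialSumset.
Variables (G : zmodType) (r : nat).

(* An ordered r-tuple (a_1, ..., a_r) is a : {ffun 'I_r -> G}, where the index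
   i : 'I_r is 0-based, so that a_i of the mathematics is a at ordinal i - 1.
   An r-partite r-uniform hypergraph H on parts A_1, ..., A_r is identified
   with its edge set, a finite subset of cartprod A. *)
Definition cartprod (A : 'I_r -> {fset G}) : {fset {ffun 'I_r -> G}} :=
  [fset [ffun i => val (f i)]
     | f : {dffun forall i : 'I_r, A i} in {: {dffun forall i : 'I_r, A i}}].

Lemma cartprodP (A : 'I_r -> {fset G}) (a : {ffun 'I_r -> G}) :
  reflect (forall i, a i \in A i) (a \in cartprod A).
Proof.
apply: (iffP (imfsetP _ _ _ _)) => [[f _ ->] i|aA]; first by rewrite ffunE; exact: valP.
exists [ffun i => FSetSub (aA i) : A i] => //.
by apply/ffunP => i; rewrite !ffunE.
Qed.

Definition hsum (H : {fset {ffun 'I_r -> G}}) : {fset G} :=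
  [fset \sum_(i < r) a i | a : {ffun 'I_r -> G} in H].

Definition sumset (A : 'I_r -> {fset G}) : {fset G} := hsum (cartprod A).

End PartialSumset.

(* Main.v *)
Require Import Defs.
From mathcomp Require Import all_boot all_order all_algebra.
From mathcomp Require Import finmap reals exp.
From mathcomp Require Import zify ring lra.

Import Order.TTheory.

Set Implicit Arguments.
Unset Strict Implicit.
Unset Printing Implicit Defensive.

Local Open Scope fset_scope.
Local Open Scope ring_scope.

(** Let S be the partial sumset of H.  Process the parts A_1, ..., A_{r-1} in
    order.  Viewing H as a dense bipartite graph between A_i and the product of
    the other (current) parts, replace A_i by a typical neighborhood B_i: this
    halves the density at worst, and all but few pairs (a, b) in B_i have many
    common neighbors w, so that a - b = (a + w) - (b + w) has many
    representations as a difference of two elements of S.  Let A_i' consist of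
    the a in B_i that form such a good pair with almost all b in B_i, and A_r'
    of the a_r with a dense link in B_1 x ... x B_{r-1}.  For a_i in A_i', most
    (b_1, ..., b_{r-1}) in the link of a_r form good pairs with the a_i, and
      a_1 + ... + a_r = sum_{i<r} (a_i - b_i) + (b_1 + ... + b_{r-1} + a_r)
    then yields many (2r-1)-tuples of elements of S, from which the left-hand
    side can be recovered.  Comparing with |S|^(2r-1) bounds the sumset.  The
    number of values of w's sum is bounded below by the size of a single other
    part; taking the largest part A_m for i <> m and A_r for i = m makes the
    sizes multiply up to at least the required power of the geometric mean. *)

(** * Double counting and dense bipartite graphs *)

Lemma card_setId_sum (T : finType) (A : {set T}) (P : pred T) :
  #|[set a in A | P a]| = (\sum_(a in A) P a)%N.
Proof.
rewrite -sum1_card big_mkcond [RHS]big_mkcond /=.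
by apply: eq_bigr => a _; rewrite inE; case: (a \in A); case: (P a).
Qed.

Lemma double_counting (T V : finType) (e : T -> V -> bool) (A : {set T})
    (W : {set V}) :
  (\sum_(v in W) #|[set a in A | e a v]| =
   \sum_(a in A) #|[set v in W | e a v]|)%N.
Proof.
under eq_bigr do rewrite card_setId_sum.
by rewrite exchange_big; apply: eq_bigr => a _; rewrite card_setId_sum.
Qed.

Lemma le_average_exists (R : realFieldType) (I : finType) (W : {set I})
    (F : I -> R) (c : R) :
  (0 < #|W|)%N -> c * #|W|%:R <= \sum_(v in W) F v ->
  exists2 v, v \in W & c <= F v.
Proof.
move=> W0 cF; apply/exists_inP; apply: contraLR cF => /exists_inPn FW.
rewrite -ltNge mulr_natr -sumr_const.
have [v vW] := card_gt0P W0.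
apply: ltr_sum => [|w wW]; last by rewrite ltNge FW.
by apply/hasP; exists v; rewrite ?mem_index_enum.
Qed.

(** The tangent line bound [F v ^+ 2 >= 2 * c * F v - c ^+ 2], summed over [W], does the work of
    Cauchy-Schwarz. *)
Lemma sqr_sum_ge (R : realFieldType) (I : finType) (W : {set I})
    (F : I -> R) (c : R) :
  0 <= c -> c * #|W|%:R <= \sum_(v in W) F v ->
  c ^+ 2 * #|W|%:R <= \sum_(v in W) F v ^+ 2.
Proof.
move=> c0 cF.
have : \sum_(v in W) (c * F v *+ 2 - c ^+ 2) <= \sum_(v in W) F v ^+ 2.
  apply: ler_sum => v _; rewrite lerBlDr -subr_ge0.
  by have -> : F v ^+ 2 + c ^+ 2 - c * F v *+ 2 = (F v - c) ^+ 2;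
    [ring|exact: sqr_ge0].
rewrite sumrB sumr_const sumrMnl -mulr_sumr -mulr_natr.
by apply: le_trans; nra.
Qed.

(* Only vertices of degree at least half the average are kept, so that every
   subset of them still spans a dense graph; among these, the neighborhood [B]
   of a typical [v] works, because a pair with few common neighbors lies in few
   neighborhoods. *)
Lemma dense_neighborhood (R : realFieldType) (T V : finType)
    (e : T -> V -> bool) (A : {set T}) (W : {set V}) (d eps : R) :
  0 < d -> 0 < eps -> (0 < #|A|)%N -> (0 < #|W|)%N ->
  d * #|A|%:R * #|W|%:R <= \sum_(a in A) #|[set v in W | e a v]|%:R ->
  exists B A' : {set T},
    [/\ A' \subset B /\ B \subset A, d / 4 * #|A|%:R <= #|B|%:R,
        d / 8 * #|A|%:R <= #|A'|%:R,
        d / 2 * #|B|%:R * #|W|%:R <= \sum_(a in B) #|[set v in W | e a v]|%:R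
      & forall a, a \in A' ->
        #|[set b in B | #|[set v in W | e a v && e b v]|%:R
             < eps * d ^+ 2 / 8 * #|W|%:R]|%:R <= 2 * eps * #|B|%:R].
Proof.
move=> d0 eps0 A0 W0 dense.
have rA0 : 0 < #|A|%:R :> R by rewrite ltr0n.
have rW0 : 0 < #|W|%:R :> R by rewrite ltr0n.
pose deg a : R := #|[set v in W | e a v]|%:R.
pose Ah := [set a in A | d / 2 * #|W|%:R <= deg a].
pose N v := [set a in Ah | e a v].
(* The value is tuned so that the bad pairs, weighted by [eps^-1], cost at most half of the lower
   bound [d ^+ 2 / 4] for the mean square of [#|N v| / #|A|]. *)
pose eta := eps * d ^+ 2 / 8.
pose bad a b := #|[set v in W | e a v && e b v]|%:R < eta * #|W|%:R.
pose nbad v : R := \sum_(a in N v) #|[set b in N v | bad a b]|%:R.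
have AhA : Ah \subset A by apply/subsetP => a; rewrite inE => /andP[].
have cardAh : #|Ah|%:R <= #|A|%:R :> R by rewrite ler_nat subset_leq_card.
(* The discarded vertices of low degree carry at most [d / 2 * #|A| * #|W|] edges. *)
have degAh : d / 2 * #|A|%:R * #|W|%:R <= \sum_(a in Ah) deg a.
  have -> : \sum_(a in Ah) deg a
      = \sum_(a in A) (if d / 2 * #|W|%:R <= deg a then deg a else 0).
    by rewrite -big_mkcondr; apply: eq_bigl => a; rewrite inE.
  have : \sum_(a in A) (deg a - d / 2 * #|W|%:R)
      <= \sum_(a in A) (if d / 2 * #|W|%:R <= deg a then deg a else 0).
    apply: ler_sum => a _; case: ifP => [_|/negbT]; last rewrite -ltNge; nra.
  rewrite sumrB sumr_const -mulr_natr; apply: le_trans.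
  by move: dense; rewrite -/deg; nra.
have cardN : \sum_(v in W) #|N v|%:R = \sum_(a in Ah) deg a.
  by rewrite -!natr_sum double_counting.
have sumN2 : (d / 2 * #|A|%:R) ^+ 2 * #|W|%:R <= \sum_(v in W) #|N v|%:R ^+ 2.
  by apply: sqr_sum_ge; rewrite ?cardN // ltW // !mulr_gt0 ?invr_gt0.
have sumbad : \sum_(v in W) nbad v <= eta * #|W|%:R * #|A|%:R ^+ 2.
  have -> : \sum_(v in W) nbad v
      = \sum_(a in Ah) \sum_(b in Ah)
          (if bad a b then #|[set v in W | e a v && e b v]|%:R else 0).
    under [RHS]eq_bigr do under eq_bigr do rewrite card_setId_sum natr_sum.
    have -> : \sum_(v in W) nbad v = \sum_(v in W) \sum_(a in Ah)
        \sum_(b in Ah) (if bad a b then (e a v && e b v)%:R else 0).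
      apply: eq_bigr => v _; rewrite /nbad big_mkcond [RHS]big_mkcond.
      apply: eq_bigr => a _; rewrite inE; case: (a \in Ah) => //=.
      case: (e a v) => /=; last by rewrite big1 // => b _; case: ifP.
      rewrite card_setId_sum natr_sum big_mkcond [RHS]big_mkcond.
      apply: eq_bigr => b _; rewrite inE; case: (b \in Ah) => //=.
      by case: (e b v); case: (bad a b).
    rewrite exchange_big; apply: eq_bigr => a _ /=.
    rewrite exchange_big; apply: eq_bigr => b _ /=.
    by case: (bad a b) => //; rewrite big1.
  have eta0 : 0 <= eta * #|W|%:R.
    by rewrite ltW // /eta !mulr_gt0 ?exprn_gt0 ?invr_gt0.
  apply: (@le_trans _ _ (\sum_(a in Ah) \sum_(b in Ah) eta * #|W|%:R)).
    by apply: ler_sum => a _; apply: ler_sum => b _; case: ifP => // /ltW.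
  rewrite !sumr_const -mulrnA -[leLHS]mulr_natr natrM; apply: ler_wpM2l => //.
  by rewrite expr2; apply: ler_pM.
(* A single average controls both quantities: dropping [nbad v] makes [N v] large, and nonnegativity
   of the left-hand side bounds [nbad v] by [eps * #|N v| ^+ 2]. *)
have [v vW Nv] : exists2 v, v \in W
    & d ^+ 2 / 8 * #|A|%:R ^+ 2 <= #|N v|%:R ^+ 2 - eps^-1 * nbad v.
  apply: le_average_exists => //; rewrite sumrB -mulr_sumr.
  have : eps^-1 * (\sum_(v in W) nbad v)
      <= eps^-1 * (eta * #|W|%:R * #|A|%:R ^+ 2).
    by rewrite ler_pM2l ?invr_gt0.
  have -> : eps^-1 * (eta * #|W|%:R * #|A|%:R ^+ 2)
      = d ^+ 2 / 8 * #|A|%:R ^+ 2 * #|W|%:R.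
    by rewrite /eta; field; rewrite gt_eqF.
  by move: sumN2; rewrite exprMn expr_div_n; lra.
have nbad0 : 0 <= nbad v by apply: sumr_ge0.
have nbadN : nbad v <= eps * #|N v|%:R ^+ 2.
  have : 0 <= d ^+ 2 / 8 * #|A|%:R ^+ 2 by rewrite ltW // !mulr_gt0 ?exprn_gt0 ?invr_gt0.
  move=> h; have {h} : eps^-1 * nbad v <= #|N v|%:R ^+ 2 by lra.
  by rewrite -(ler_pM2l eps0) mulrA divff ?gt_eqF // mul1r.
have N_ge : d / 4 * #|A|%:R <= #|N v|%:R.
  rewrite -(@ler_pXn2r _ 2) ?nnegrE ?ler0n //; last by rewrite ltW // !mulr_gt0 ?invr_gt0.
  have : 0 <= eps^-1 * nbad v by rewrite mulr_ge0 // invr_ge0 ltW.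
  by move: Nv (sqr_ge0 (d * #|A|%:R)); rewrite !exprMn; lra.
have N0 : 0 < #|N v|%:R :> R by apply: lt_le_trans N_ge; rewrite !mulr_gt0 ?invr_gt0.
pose few a := #|[set b in N v | bad a b]|%:R <= 2 * eps * #|N v|%:R.
exists (N v), [set a in N v | few a]; split.
- split; first by apply/subsetP => a; rewrite inE => /andP[].
  by apply: subset_trans AhA; apply/subsetP => a; rewrite inE => /andP[].
- exact: N_ge.
- have cardC : #|[set a in N v | few a]|%:R + #|[set a in N v | ~~ few a]|%:R
      = #|N v|%:R :> R.
    rewrite -natrD -[in RHS]sum1_card !card_setId_sum -big_split; congr (_%:R).
    by apply: eq_bigr => a _; case: (few a).
  (* Markov's inequality: each vertex outside [few] accounts for at least [2 * eps * #|N v|] bad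
     pairs, so these vertices form at most half of [N v]. *)
  have : #|[set a in N v | ~~ few a]|%:R * (2 * eps * #|N v|%:R) <= nbad v.
    rewrite card_setId_sum natr_sum mulr_suml; apply: ler_sum => a _.
    case: (boolP (few a)) => [_|]; first by rewrite mul0r.
    by rewrite mul1r /few -ltNge => /ltW.
  move: cardC N_ge; set x := #|_|%:R; set y := #|_|%:R => xy N_ge xbad.
  have {xbad}: y * 2 <= #|N v|%:R.
    rewrite -(ler_pM2r (mulr_gt0 eps0 N0)) mulrA -(mulrA y) (mulrA y).
    have -> : #|N v|%:R * (eps * #|N v|%:R) = eps * #|N v|%:R ^+ 2 :> R by ring.
    by apply: le_trans nbadN; rewrite -!mulrA in xbad *.
  by move: xy N_ge; clear; lra.
- rewrite mulrAC mulr_natr -sumr_const; apply: ler_sum => a.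
  by rewrite !inE => /andP[/andP[]].
- by move=> a; rewrite !inE => /andP[].
Qed.

Lemma card_fibers (T V : finType) (D : {set V}) (g : V -> T) (A : {set T}) :
  {in D, forall f, g f \in A} ->
  (\sum_(a in A) #|[set f in D | g f == a]| = #|D|)%N.
Proof.
move=> gA; rewrite -double_counting -sum1_card.
apply: eq_bigr => f fD; rewrite -[RHS](cards1 (g f)); apply: eq_card => a.
by rewrite !inE eq_sym; case: eqP => [->|]; rewrite ?gA ?andbF.
Qed.

(** * Product sets and changes of one coordinate *)

Definition fupd (I : eqType) (X : Type) (F : I -> X) (i : I) (x : X) (j : I) :=
  if j == i then x else F j.

Definition tupd (I : finType) (T : Type) (v : {ffun I -> T}) (i : I) (a : T) :
  {ffun I -> T} := [ffun j => fupd v i a j].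

Definition box (I T : finType) (X : I -> {set T}) : {set {ffun I -> T}} :=
  [set f : {ffun I -> T} | [forall i, f i \in X i]].

Lemma fupd_same (I : eqType) (X : Type) (F : I -> X) i x : fupd F i x i = x.
Proof. by rewrite /fupd eqxx. Qed.

Lemma fupd_neq (I : eqType) (X : Type) (F : I -> X) i x j :
  j != i -> fupd F i x j = F j.
Proof. by rewrite /fupd => /negPf->. Qed.

Section Boxes.
Variables I T : finType.
Implicit Types (X : I -> {set T}) (v f : {ffun I -> T}).

Lemma boxP X f : reflect (forall i, f i \in X i) (f \in box X).
Proof. by rewrite inE; exact: forallP. Qed.

Lemma eq_box X Y : X =1 Y -> box X = box Y.
Proof.
move=> XY; apply/setP => f.
by apply/boxP/boxP => h i; rewrite ?XY // -XY.
Qed.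

Lemma card_box X : #|box X| = (\prod_i #|X i|)%N.
Proof.
under eq_bigr do rewrite -sum1_card.
rewrite bigA_distr_big_dep -sum1_card; apply: eq_big => [f|f _].
  by apply/boxP/familyP.
by rewrite big1.
Qed.

(** The product form avoids dividing by [#|X i|], so an empty [X i] needs no separate case. *)
Lemma card_box_fupd X i Y :
  (#|box (fupd X i Y)| * #|X i| = #|Y| * #|box X|)%N.
Proof.
rewrite !card_box [in LHS](bigD1 i) //= [in RHS](bigD1 i) //= fupd_same.
rewrite -!mulnA; congr (_ * _)%N; rewrite mulnC; congr (_ * _)%N.
by apply: eq_bigr => j ji; rewrite fupd_neq.
Qed.

(** Freezing coordinate [i] at a dummy value [t0] models the product of the other parts without
    changing the index type. Each tuple of [box X] splits uniquely into its [i]-th entry and such a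
    frozen tuple. *)
Lemma card_box_slices X i t0 (P : pred {ffun I -> T}) :
  (\sum_(a in X i) #|[set v in box (fupd X i [set t0]) | P (tupd v i a)]| =
   #|[set f in box X | P f]|)%N.
Proof.
rewrite -(@card_fibers _ _ _ (fun f => f i) (X i)); last first.
  by move=> f /setIdP[/boxP fX _]; exact: fX.
apply: eq_bigr => a aX.
rewrite -[LHS](@card_in_imset _ _ (fun v => tupd v i a)); last first.
  move=> v w /setIdP[/boxP vb _] /setIdP[/boxP wb _] /ffunP vw.
  apply/ffunP => j; have := vw j; rewrite !ffunE /fupd; case: eqP => // -> _.
  by have := vb i; have := wb i; rewrite fupd_same !inE => /eqP-> /eqP->.
apply: eq_card => f; apply/imsetP/idP => [[v /setIdP[/boxP vb Pv] ->]|].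
  rewrite !inE Pv ffunE fupd_same eqxx !andbT; apply/forallP => j.
  rewrite ffunE; have := vb j; rewrite /fupd; case: eqP => // -> _; exact: aX.
rewrite inE => /andP[/setIdP[/boxP fX Pf] /eqP fia].
have fE : f = tupd (tupd f i t0) i a.
  by apply/ffunP => j; rewrite ffunE /fupd ffunE /fupd; case: eqP => // ->.
exists (tupd f i t0) => //; apply/setIdP; rewrite -fE; split=> //.
apply/boxP => j; rewrite ffunE /fupd; case: eqP => //; by rewrite inE.
Qed.

End Boxes.

(** * From common neighbors to popular differences *)

Section PopularDifferences.
Variables (G : zmodType) (S : {fset G}).

(* The representations [x - y = s - s'] of a difference with [s], [s'] in [S]. *)
Definition shifts (x y : G) : {set S} := [set s : S | val s - x + y \in S].

Variables (I T : finType) (phi : T -> G) (H : {set {ffun I -> T}}).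
Hypothesis phi_inj : injective phi.
Hypothesis sumH : {in H, forall f : {ffun I -> T}, \sum_i phi (f i) \in S}.

Lemma sum_tupd (v : {ffun I -> T}) i a :
  \sum_j phi (tupd v i a j) = phi a + \sum_(j | j != i) phi (v j).
Proof.
rewrite (bigD1 i) //= ffunE fupd_same; congr (_ + _).
by apply: eq_bigr => j ji; rewrite ffunE fupd_neq.
Qed.

(* A common neighbor is determined by the sum of its coordinates together with
   all coordinates but the [l]-th. *)
Lemma card_common_le_shifts (X : I -> {set T}) i l t0 a b :
  l != i ->
  (#|[set v in box (fupd X i [set t0])
        | (tupd v i a \in H) && (tupd v i b \in H)]| * #|X l|
   <= #|shifts (phi a) (phi b)| * #|box (fupd X i [set t0])|)%N.
Proof.
move=> li; set X0 := fupd X i _; set D := [set v in _ | _].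
have [->|[v0 v0D]] := set_0Vmem D; first by rewrite cards0.
have Dsum v : v \in D -> \sum_j phi (tupd v i a j) \in S.
  by move=> /setIdP[_ /andP[/sumH]].
(* Only a default for [insubd]: on [D] the sum lies in [S], so the default never interferes with
   injectivity of [g]. *)
pose s0 : S := FSetSub (Dsum _ v0D).
pose g v : S * {ffun I -> T} :=
  (insubd s0 (\sum_j phi (tupd v i a j)), tupd v l t0).
have gD : g @: D \subset setX (shifts (phi a) (phi b)) (box (fupd X0 l [set t0])).
  apply/subsetP => p /imsetP[v vD ->]; rewrite in_setX; apply/andP; split.
    rewrite inE /= insubdK; last exact: (Dsum v vD).
    have /setIdP[_ /andP[_ /sumH]] := vD; rewrite !sum_tupd.
    by rewrite (addrC (phi a)) addrK (addrC (phi b)).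
  have /setIdP[/boxP vb _] := vD; apply/boxP => j.
  by rewrite ffunE; have := vb j; rewrite /fupd; case: eqP => //; rewrite inE.
have g_inj : {in D &, injective g}.
  move=> v w vD wD [/(congr1 val)]; rewrite !insubdK; [|exact: (Dsum w wD)|exact: (Dsum v vD)].
  rewrite !sum_tupd => /addrI; rewrite (bigD1 l) //= [RHS](bigD1 l) //=.
  move=> svw /ffunP vw.
  have vwj j : j != l -> v j = w j.
    by move=> jl; have := vw j; rewrite !ffunE !fupd_neq.
  have : phi (v l) = phi (w l).
    move: svw; rewrite (eq_bigr (fun j => phi (w j))) => [/addIr //|j].
    by move=> /andP[_ /vwj->].
  move/phi_inj => vwl; apply/ffunP => j.
  by have [->|/vwj] := eqVneq j l.
have : (#|D| <= #|shifts (phi a) (phi b)| * #|box (fupd X0 l [set t0])|)%N.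
  by rewrite -(card_in_imset g_inj) -cardsX subset_leq_card.
move=> /(leq_mul (leqnn #|X l|)); rewrite mulnC => /leq_trans; apply.
have := card_box_fupd X0 l [set t0]; rewrite cards1 mul1n.
by rewrite {2}/X0 fupd_neq // => <-; rewrite mulnCA leq_mul // mulnC.
Qed.

(** [dense_neighborhood] is applied to the graph between [X i] and the box frozen at [i]. By
    [card_common_le_shifts], a pair with few shifts relative to some [X l] has few common neighbors,
    so it is already among the bad pairs there. *)
Lemma dense_slice (R : realFieldType) (X : I -> {set T}) (i : I) (d eps : R) :
  0 < d -> 0 < eps -> (forall j, 0 < #|X j|)%N ->
  d * #|box X|%:R <= #|[set f in box X | f \in H]|%:R ->
  exists B A' : {set T},
    [/\ A' \subset B /\ B \subset X i, d / 4 * #|X i|%:R <= #|B|%:R,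
        d / 8 * #|X i|%:R <= #|A'|%:R,
        d / 2 * #|box (fupd X i B)|%:R
          <= #|[set f in box (fupd X i B) | f \in H]|%:R
      & forall a, a \in A' ->
        #|[set b in B | [exists l, (l != i) &&
             (#|shifts (phi a) (phi b)|%:R < eps * d ^+ 2 / 8 * #|X l|%:R)]]|%:R
        <= 2 * eps * #|B|%:R].
Proof.
move=> d0 eps0 X0 dense; have [t0 t0X] := card_gt0P (X0 i).
pose W := box (fupd X i [set t0]).
have cardW Y : (#|box (fupd X i Y)| = #|Y| * #|W|)%N.
  have := card_box_fupd (fupd X i Y) i [set t0]; rewrite cards1 mul1n => <-.
  rewrite fupd_same mulnC; congr (_ * _)%N; congr #|pred_of_set _|.
  by apply: eq_box => j; rewrite /fupd; case: eqP.
have cardX : (#|box X| = #|X i| * #|W|)%N.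
  by rewrite -cardW; congr #|pred_of_set _|; apply: eq_box => j;
    rewrite /fupd; case: eqP => // ->.
have W0 : (0 < #|W|)%N.
  rewrite card_box prodn_gt0 // => j; rewrite /fupd; case: eqP => // _.
  by rewrite cards1.
have [] := @dense_neighborhood R _ _ (fun a v => tupd v i a \in H) (X i) W d eps.
- exact: d0.
- exact: eps0.
- exact: X0.
- exact: W0.
- rewrite -natr_sum (card_box_slices X i t0 (fun f => f \in H)).
  by rewrite -mulrA -natrM -cardX.
move=> B [A' [sub cB cA' eB bad]]; exists B, A'; split=> //.
  rewrite cardW natrM mulrA (le_trans eB) // -natr_sum ler_nat.
  have := card_box_slices (fupd X i B) i t0 (fun f => f \in H).
  rewrite fupd_same => <-; apply: leq_sum => a _; apply: subset_leq_card.
  apply/subsetP => v; rewrite !inE => /andP[/forallP vW ->]; rewrite andbT.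
  by apply/forallP => j; have := vW j; rewrite /fupd; case: eqP.
move=> a /bad; apply: le_trans; rewrite ler_nat; apply: subset_leq_card.
apply/subsetP => b; rewrite !inE => /andP[-> /existsP[l /andP[li lt_sh]]] /=.
rewrite ltNge; apply: contraL lt_sh => le_com; rewrite -leNgt.
rewrite -(@ler_pM2r _ #|W|%:R) ?ltr0n // mulrAC.
apply: (@le_trans _ _ (#|[set v in W | (tupd v i a \in H) && (tupd v i b \in H)]|%:R
  * #|X l|%:R)); first by rewrite ler_wpM2r.
by rewrite -!natrM ler_nat card_common_le_shifts.
Qed.

End PopularDifferences.

(** * Restricting the parts one after another *)

Section Restriction.
Variables (R : realFieldType) (G : zmodType) (S : {fset G}).
Variables (n : nat) (T : finType) (phi : T -> G).
Variables (A : 'I_n.+1 -> {set T}) (H : {set {ffun 'I_n.+1 -> T}}).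
Variables (delta eps : R).
Hypothesis phi_inj : injective phi.
Hypothesis sumH :
  {in H, forall f : {ffun 'I_n.+1 -> T}, \sum_i phi (f i) \in S}.
Hypothesis A_gt0 : forall i, (0 < #|A i|)%N.
Hypotheses (delta_gt0 : 0 < delta) (delta_le1 : delta <= 1) (eps_gt0 : 0 < eps).

(** The density guaranteed after all [n] halvings, hence a lower bound for the one guaranteed at
    every stage. *)
Definition dmin : R := delta / 2 ^+ n.

(* The factor [dmin / 4] pays for the sets restricted before the [i]-th one;
   nothing has been restricted before the first. *)
Definition threshold (i : 'I_n.+1) : R :=
  eps * dmin ^+ 2 / 8 * (if i == ord0 then 1 else dmin / 4).

(** All [l] other than [i] are covered because the reference part is chosen only in the final count.
    Sizes refer to the original [A l], so later restrictions do not affect goodness. *)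
Definition good (i : 'I_n.+1) (a b : T) : bool :=
  [forall l, (l != i) ==>
     (threshold i * #|A l|%:R <= #|shifts S (phi a) (phi b)|%:R)].

Lemma dmin_gt0 : 0 < dmin.
Proof. by rewrite divr_gt0 ?exprn_gt0. Qed.

Lemma dmin4_gt0 : 0 < dmin / 4.
Proof. by rewrite divr_gt0 ?dmin_gt0. Qed.

Lemma dmin_le k : (k <= n)%N -> dmin <= delta / 2 ^+ k.
Proof.
move=> kn; rewrite /dmin ler_pM2l // lef_pV2 ?posrE ?exprn_gt0 //.
by rewrite ler_weXn2l // ler1n.
Qed.

Hypothesis dense : delta * #|box A|%:R <= #|[set f in box A | f \in H]|%:R.

(** Induction on the number [k] of processed parts. Step [k] changes only part [k], and the
    properties recorded for an earlier part involve no other restricted part, so they persist. *)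
Lemma restriction (k : nat) : (k <= n)%N ->
  exists B A' : 'I_n.+1 -> {set T},
    [/\ forall i, B i \subset A i, forall i : 'I_n.+1, (k <= i)%N -> B i = A i,
        delta / 2 ^+ k * #|box B|%:R <= #|[set f in box B | f \in H]|%:R,
        forall i : 'I_n.+1, (i < k)%N -> [/\ A' i \subset B i,
          dmin / 4 * #|A i|%:R <= #|B i|%:R
          & delta / 2 ^+ i / 8 * #|A i|%:R <= #|A' i|%:R]
      & forall i : 'I_n.+1, (i < k)%N -> forall a, a \in A' i ->
          #|[set b in B i | ~~ good i a b]|%:R <= 2 * eps * #|B i|%:R].
Proof.
elim: k => [_|k IHk kn].
  by exists A, A; split=> //; rewrite expr0 divr1.
have [B [A' [BA Bge dB small bad]]] := IHk (ltnW kn).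
pose i0 : 'I_n.+1 := inord k.
have i0k : i0 = k :> nat by rewrite inordK // ltnW.
have neq_i0 (i : 'I_n.+1) : (i < k)%N -> i != i0.
  by move=> ik; rewrite -val_eqE /= i0k ltn_eqF.
have Bi0 : B i0 = A i0 by apply: Bge; rewrite i0k.
have dk0 : 0 < delta / 2 ^+ k by rewrite divr_gt0 ?exprn_gt0.
have dmink : dmin <= delta / 2 ^+ k by apply: dmin_le; exact: ltnW.
have B_ge l : dmin / 4 * #|A l|%:R <= #|B l|%:R.
  have [/small[]//|/Bge->] := ltnP l k.
  rewrite ler_piMl // ler_pdivrMr // mul1r.
  by apply: (le_trans (dmin_le (leq0n n))); rewrite expr0 divr1 (le_trans delta_le1) // ler1n.
have B_gt0 l : (0 < #|B l|)%N.
  rewrite -(ltr0n R); apply: lt_le_trans (B_ge l).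
  by rewrite mulr_gt0 ?dmin4_gt0 // ltr0n.
have [Y [A0 [[A0Y YB] cY cA0 dY badY]]] :=
  dense_slice phi_inj sumH i0 dk0 eps_gt0 B_gt0 dB.
exists (fupd B i0 Y), (fupd A' i0 A0); split.
- by move=> i; rewrite /fupd; case: eqP => // ->; rewrite -Bi0.
- move=> i ki; rewrite fupd_neq ?Bge 1?ltnW //.
  by rewrite -val_eqE /= i0k gtn_eqF.
- by rewrite exprSr invfM mulrA.
- move=> i; rewrite ltnS leq_eqVlt => /orP[/eqP ik|ik]; last first.
    by rewrite !fupd_neq ?neq_i0 //; exact: small.
  have -> : i = i0 by apply: val_inj; rewrite /= i0k.
  rewrite !fupd_same; split=> //; last by rewrite i0k -Bi0.
  rewrite -Bi0; apply: le_trans cY; apply: ler_wpM2r => //.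
  by rewrite ler_pM2r ?invr_gt0.
- move=> i; rewrite ltnS leq_eqVlt => /orP[/eqP ik|ik]; last first.
    by rewrite !fupd_neq ?neq_i0 //; exact: bad.
  have {ik} -> : i = i0 by apply: val_inj; rewrite /= i0k.
  rewrite !fupd_same => a /badY; apply: le_trans.
  rewrite ler_nat; apply: subset_leq_card; apply/subsetP => b.
  rewrite !inE => /andP[-> /forallPn[l]] /=.
  rewrite negb_imply -ltNge => /andP[li lt_sh]; apply/existsP; exists l.
  (* The threshold supplied by [dense_slice] uses the current density and the current [B l]; both
     are replaced by their uniform lower bounds in terms of [dmin] and [A l]. *)
  rewrite li; apply: lt_le_trans lt_sh _; rewrite /threshold.
  have edk : eps * dmin ^+ 2 / 8 <= eps * (delta / 2 ^+ k) ^+ 2 / 8.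
    rewrite ler_pM2r ?invr_gt0 // ler_pM2l //.
    by rewrite ler_pXn2r // nnegrE ltW // dmin_gt0.
  have ed0 : 0 <= eps * dmin ^+ 2 / 8.
    by rewrite ltW // divr_gt0 // mulr_gt0 // exprn_gt0 // dmin_gt0.
  have Al0 : 0 <= dmin / 4 * #|A l|%:R.
    by rewrite ltW // mulr_gt0 ?dmin4_gt0 // ltr0n.
  rewrite -mulrA; apply: ler_pM => //; case: eqP => i00; rewrite ?mul1r //.
  by rewrite Bge // -i0k i00.
Qed.

End Restriction.

(** * Counting representations of a sum *)

Lemma ord_widen_or_max n (j : 'I_n.+1) :
  j = ord_max \/ exists i, j = widen_ord (leqnSn n) i.
Proof.
have [->|jn] := eqVneq j ord_max; [by left|right].
have jn' : (j < n)%N.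
  rewrite ltn_neqAle -ltnS ltn_ord andbT.
  by apply: contraNneq jn => jn; apply/eqP/val_inj.
by exists (Ordinal jn'); apply: val_inj.
Qed.

(** For [f] in [D], take [x i] in the shifts of the pair [a i], [f i], set [y i = x i - a i + f i]
    (reading entries through [phi]), and append the sum of [f]. Then the differences [x i - y i] and
    the last entry telescope to the sum of [a]. Conversely [x], [y] and [a] recover [f], so distinct
    [f] give disjoint sets of tuples. *)
Lemma card_shift_tuples (G : zmodType) (S : {fset G}) (n : nat) (T : finType)
    (phi : T -> G) (phi_inj : injective phi) (a : {ffun 'I_n.+1 -> T})
    (D : {set {ffun 'I_n.+1 -> T}}) :
  {in D, forall f : {ffun 'I_n.+1 -> T},
     f ord_max = a ord_max /\ \sum_i phi (f i) \in S} ->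
  (\sum_(f in D) \prod_(i < n)
     #|shifts S (phi (a (widen_ord (leqnSn n) i)))
                (phi (f (widen_ord (leqnSn n) i)))|
   <= #|[set p : {ffun 'I_n -> S} * {ffun 'I_n -> S} * S |
         (\sum_i (val (p.1.1 i) - val (p.1.2 i)) + val p.2
         == \sum_i phi (a i))%R]|)%N.
Proof.
move=> Dsum; set w := widen_ord _; set P := [set p | _].
pose rel f (p : {ffun 'I_n -> S} * {ffun 'I_n -> S} * S) :=
  [forall i, val (p.1.2 i) == val (p.1.1 i) - phi (a (w i)) + phi (f (w i))].
apply: (@leq_trans (\sum_(f in D) #|[set p in P | rel f p]|)); last first.
  rewrite -double_counting -sum1_card; apply: leq_sum => p _.
  apply/card_le1_eqP => f g; rewrite !inE.
  move=> /andP[/Dsum[fa _] /forallP fp] /andP[/Dsum[ga _] /forallP gp].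
  apply/ffunP => j; have [->|[i ->]] := ord_widen_or_max j; first by rewrite fa ga.
  apply: phi_inj; have := fp i; rewrite (eqP (gp i)) => /eqP.
  by move=> /addrI.
apply: leq_sum => f fD; have [fa fS] := Dsum _ fD.
rewrite -(card_box (fun i => shifts S (phi (a (w i))) (phi (f (w i))))).
pose s0 : S := FSetSub fS.
pose y (x : {ffun 'I_n -> S}) : {ffun 'I_n -> S} :=
  [ffun i => insubd s0 (val (x i) - phi (a (w i)) + phi (f (w i)))].
rewrite -(@card_in_imset _ _ (fun x => (x, y x, s0))); last first.
  by move=> x x' _ _ [].
apply: subset_leq_card; apply/subsetP => p /imsetP[x /boxP xb ->].
have yE i : val (y x i) = val (x i) - phi (a (w i)) + phi (f (w i)).
  by rewrite ffunE insubdK //; have := xb i; rewrite inE.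
rewrite !inE /=; apply/andP; split; last by apply/forallP => i; rewrite yE.
rewrite !big_ord_recr /= fa addrA -big_split /=; apply/eqP; congr (_ + _).
by apply: eq_bigr => i _; rewrite yE -/w opprD opprB addrA addrCA subrr addr0 subrK.
Qed.

Lemma leq_card_bigcup (I T : finType) (F : I -> {set T}) :
  (#|\bigcup_i F i| <= \sum_i #|F i|)%N.
Proof.
elim/big_rec2: _ => [|i x X _ Xx]; first by rewrite cards0.
by apply: leq_trans (leq_card_setU _ _) _; rewrite leq_add2l.
Qed.

(** Fibers below [d / 2 * c] contribute at most half of the required total, and each remaining fiber
    contributes at most [c]. *)
Lemma card_fibers_dense (R : realFieldType) (T V : finType) (D : {set V})
    (g : V -> T) (A : {set T}) (d c : R) :
  0 < d -> 0 < c -> {in D, forall f, g f \in A} ->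
  (forall a, #|[set f in D | g f == a]|%:R <= c) ->
  d * c * #|A|%:R <= #|D|%:R ->
  d / 2 * #|A|%:R
    <= #|[set a in A | d / 2 * c <= #|[set f in D | g f == a]|%:R]|%:R.
Proof.
move=> d0 c0 gA fc; rewrite -(card_fibers gA) natr_sum => dc.
rewrite -(ler_pM2r c0) card_setId_sum natr_sum mulr_suml.
have : \sum_(a in A) (#|[set f in D | g f == a]|%:R - d / 2 * c)
    <= \sum_(a in A)
         (d / 2 * c <= #|[set f in D | g f == a]|%:R)%R%:R * c.
  apply: ler_sum => a _; have := fc a; set x := #|_|%:R => xc.
  case: (leP (d / 2 * c) x) => xd /=; rewrite ?mul1r ?mul0r; last by lra.
  by have : 0 < d / 2 * c; [rewrite !mulr_gt0 ?invr_gt0 | lra].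
rewrite sumrB sumr_const -[X in _ - X]mulr_natr; apply: le_trans.
move: dc; set s := \sum_(_ in _) _; set y := #|A|%:R; lra.
Qed.

Lemma widen_ord_neq_max n (i : 'I_n) : widen_ord (leqnSn n) i != ord_max.
Proof. by rewrite -val_eqE /= ltn_eqF. Qed.

Lemma card_box_fupd_max n (T : finType) (B : 'I_n.+1 -> {set T}) (t : T) :
  (#|box (fupd B ord_max [set t])|
   = \prod_(i < n) #|B (widen_ord (leqnSn n) i)|)%N.
Proof.
rewrite card_box big_ord_recr /= fupd_same cards1 muln1.
by apply: eq_bigr => i _; rewrite fupd_neq // widen_ord_neq_max.
Qed.

(** The reference part is [m] for every [i] other than [m], and the last part for [i = m]. If [m] is
    itself last, the exception never occurs and the count is the same. *)
Lemma prod_widen_other (R : comNzRingType) n (x : 'I_n.+1 -> R) (m : 'I_n.+1) :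
  (0 < n)%N ->
  \prod_(i < n) x (widen_ord (leqnSn n) i) *
  \prod_(i < n) x (if widen_ord (leqnSn n) i == m then ord_max else m)
  = \prod_i x i * x m ^+ n.-1.
Proof.
move=> n0; rewrite [in RHS]big_ord_recr -mulrA; congr (_ * _).
have [->|[m0 ->]] := ord_widen_or_max m.
  rewrite -exprS prednK // (eq_bigr (fun=> x ord_max)).
    by rewrite prodr_const card_ord.
  by move=> i _; case: ifP.
rewrite (bigD1 m0) //= eqxx; congr (_ * _).
rewrite (eq_bigr (fun=> x (widen_ord (leqnSn n) m0))).
  rewrite (eq_bigl [in predC1 m0]) => [|i]; last by rewrite inE.
  by rewrite prodr_const cardC1 card_ord.
move=> i im; case: eqP => // /(congr1 val) /= h.
by rewrite (val_inj h) eqxx in im.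
Qed.

Section Count.
Variables (R : realFieldType) (G : zmodType) (S : {fset G}).
Variables (n : nat) (T : finType) (phi : T -> G).
Variables (A B A' : 'I_n.+1 -> {set T}) (H : {set {ffun 'I_n.+1 -> T}}).
Variables (delta eps : R).
Hypothesis phi_inj : injective phi.
Hypothesis sumH :
  {in H, forall f : {ffun 'I_n.+1 -> T}, \sum_i phi (f i) \in S}.
Hypotheses (n_gt0 : (0 < n)%N) (delta_gt0 : 0 < delta) (eps_gt0 : 0 < eps).
Hypothesis epsE : eps = dmin n delta / (8 * n%:R).
Hypothesis B_gt0 : forall i, (0 < #|B i|)%N.

Local Notation w := (widen_ord (leqnSn n)).
Local Notation d := (dmin n delta).
Local Notation good := (good S phi A delta eps).

(** A union bound removes from the link of [a ord_max] the tuples forming a bad pair with [a] in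
    some coordinate. Each survivor feeds [card_shift_tuples], with shift counts bounded below by
    goodness against the reference part. *)
Lemma card_representations (a : {ffun 'I_n.+1 -> T}) (m : 'I_n.+1) :
  a \in box A' ->
  (forall (i : 'I_n) b, b \in A' (w i) ->
     #|[set c in B (w i) | ~~ good (w i) b c]|%:R <= 2 * eps * #|B (w i)|%:R) ->
  d / 2 * (\prod_(i < n) #|B (w i)|)%:R
    <= #|[set f in [set f in box B | f \in H] | f ord_max == a ord_max]|%:R ->
  d / 4 * (\prod_(i < n) #|B (w i)|)%:R *
    \prod_(i < n) (threshold delta eps (w i)
                   * #|A (if w i == m then ord_max else m)|%:R)
  <= #|[set p : {ffun 'I_n -> S} * {ffun 'I_n -> S} * S |
         \sum_i (val (p.1.1 i) - val (p.1.2 i)) + val p.2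
         == \sum_i phi (a i)]|%:R.
Proof.
move=> /boxP aA' bad; set PB := (\prod_(i < n) _)%N; set link := [set f in _ | _].
move=> link_ge.
pose D := [set f in link | [forall i, good (w i) (a (w i)) (f (w i))]].
pose badset i := [set c in B (w i) | ~~ good (w i) (a (w i)) c].
pose Ba := fupd B ord_max [set a ord_max].
have d0 : 0 < d by exact: dmin_gt0.
have badbox i : #|box (fupd Ba (w i) (badset i))|%:R <= 2 * eps * PB%:R.
  have Bi0 : 0 < #|B (w i)|%:R :> R by rewrite ltr0n.
  rewrite -(ler_pM2r Bi0).
  have := card_box_fupd Ba (w i) (badset i).
  rewrite {2}/Ba fupd_neq ?widen_ord_neq_max // card_box_fupd_max -/PB.
  move=> /(congr1 (fun k => k%:R : R)); rewrite !natrM => ->.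
  rewrite mulrAC; apply: ler_wpM2r => //; exact: bad.
have cardD : d / 4 * PB%:R <= #|D|%:R.
  have sub : link \subset D :|: \bigcup_i box (fupd Ba (w i) (badset i)).
    apply/subsetP => f fl; rewrite in_setU inE fl /=.
    case: forallP => //= /forallP/forallPn[i ngood]; apply/bigcupP; exists i => //.
    have /setIdP[/setIdP[/boxP fB _] /eqP fa] := fl.
    apply/boxP => j; rewrite /fupd; case: eqP => [->|_].
      by rewrite inE fB.
    by rewrite /Ba /fupd; case: eqP => [->|_]; rewrite ?inE ?fa.
  have : #|link|%:R <= #|D|%:R + \sum_(i < n) 2 * eps * PB%:R.
    apply: (@le_trans _ _ (#|D| + \sum_(i < n)
        #|box (fupd Ba (w i) (badset i))|)%:R).
      rewrite ler_nat (leq_trans (subset_leq_card sub)) //.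
      by rewrite (leq_trans (leq_card_setU _ _)) // leq_add2l leq_card_bigcup.
    by rewrite natrD natr_sum lerD2l; apply: ler_sum.
  (* This fixes [eps]: the [n] bad sets together take at most half of the link density [d / 2]. *)
  have -> : \sum_(i < n) 2 * eps * PB%:R = d / 4 * PB%:R.
    rewrite sumr_const card_ord -mulr_natr epsE; field.
    by rewrite pnatr_eq0 -lt0n.
  by move: link_ge; lra.
have th0 (i : 'I_n.+1) : 0 <= threshold delta eps i.
  rewrite /threshold; apply: mulr_ge0.
    by rewrite ltW // divr_gt0 // mulr_gt0 // exprn_gt0.
  by case: eqP => // _; rewrite ltW // dmin4_gt0.
have c0 : 0 <= \prod_(i < n) (threshold delta eps (w i)
    * #|A (if w i == m then ord_max else m)|%:R).
  by apply: prodr_ge0 => i _; rewrite mulr_ge0.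
apply: le_trans (ler_wpM2r c0 cardD) _.
have Dsum : {in D, forall f : {ffun 'I_n.+1 -> T},
    f ord_max = a ord_max /\ \sum_i phi (f i) \in S}.
  by move=> f /setIdP[/setIdP[/setIdP[_ /sumH ?] /eqP ?] _].
have := card_shift_tuples phi_inj Dsum; rewrite -(ler_nat R); apply: le_trans.
rewrite natr_sum mulr_natl -sumr_const; apply: ler_sum => f.
move=> /setIdP[_ /forallP fgood]; rewrite natr_prod.
apply: ler_prod => i _; rewrite mulr_ge0 //=.
have /forallP := fgood i; move=> /(_ (if w i == m then ord_max else m)).
move=> /implyP; apply; case: (eqVneq (w i) m) => [_|]; last by rewrite eq_sym.
by rewrite eq_sym widen_ord_neq_max.
Qed.

End Count.

(** * Bounding the restricted sumset *)

Lemma prod_threshold (R : realFieldType) n (delta eps : R) : (0 < n)%N ->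
  \prod_(i < n) threshold delta eps (widen_ord (leqnSn n) i)
  = (eps * dmin n delta ^+ 2 / 8) ^+ n * (dmin n delta / 4) ^+ n.-1.
Proof.
case: n => // n _; rewrite /threshold big_split /= prodr_const card_ord.
by rewrite big_ord_recl /= mul1r prodr_const card_ord.
Qed.

(** Each [q] in [Q] is represented by at least [M] tuples over [S] of length [2 * n + 1], and a
    tuple represents only one [q]; hence [M * #|Q|] is at most the number of all tuples. *)
Lemma restricted_sumset (R : realFieldType) (G : zmodType) (S : {fset G}) (n : nat)
    (T : finType) (phi : T -> G) (A : 'I_n.+1 -> {set T})
    (H : {set {ffun 'I_n.+1 -> T}}) (delta : R) (m : 'I_n.+1) :
  injective phi ->
  {in H, forall f : {ffun 'I_n.+1 -> T}, \sum_i phi (f i) \in S} ->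
  (0 < n)%N -> 0 < delta -> delta <= 1 -> (forall i, 0 < #|A i|)%N ->
  delta * #|box A|%:R <= #|[set f in box A | f \in H]|%:R ->
  exists A' : 'I_n.+1 -> {set T},
    [/\ forall i, A' i \subset A i,
        forall i : 'I_n.+1, delta / 2 ^+ i / 8 * #|A i|%:R <= #|A' i|%:R
      & forall Q : {fset G},
          {in Q, forall q, exists2 a, a \in box A' & q = \sum_i phi (a i)} ->
          dmin n delta ^+ (5 * n) * (\prod_i #|A i|%:R * #|A m|%:R ^+ n.-1)
            * #|` Q|%:R
          <= 2 ^+ (10 * n) * n%:R ^+ n * #|` S|%:R ^+ (2 * n).+1].
Proof.
move=> phi_inj sumH n0 delta0 delta1 A0 dense.
pose d := dmin n delta; pose eps := d / (8 * n%:R).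
have d0 : 0 < d by exact: dmin_gt0.
have eps0 : 0 < eps by rewrite divr_gt0 // mulr_gt0 // ltr0n.
have [B [A' [BA Bge dB small bad]]] :=
  restriction phi_inj sumH A0 delta0 delta1 eps0 dense (leqnn n).
have B_ge l : d / 4 * #|A l|%:R <= #|B l|%:R.
  have [/small[]//|/Bge->] := ltnP l n.
  rewrite ler_piMl // ler_pdivrMr // mul1r.
  apply: (le_trans (dmin_le delta0 (leq0n n))).
  by rewrite expr0 divr1 (le_trans delta1) // ler1n.
have B0 l : (0 < #|B l|)%N.
  rewrite -(ltr0n R); apply: lt_le_trans (B_ge l).
  by rewrite mulr_gt0 ?dmin4_gt0 // ltr0n.
pose w := widen_ord (leqnSn n).
pose PB := (\prod_(i < n) #|B (w i)|)%N.
have PB0 : 0 < PB%:R :> R by rewrite ltr0n prodn_gt0.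
pose HB := [set f in box B | f \in H].
(* The last part is never restricted; it only loses the vertices whose link is sparse in the product
   of the other [B i]. *)
pose last := [set t in A ord_max | d / 2 * PB%:R
                <= #|[set f in HB | f ord_max == t]|%:R].
have Bmax : B ord_max = A ord_max by exact: Bge.
have card_last : d / 2 * #|A ord_max|%:R <= #|last|%:R.
  apply: (@card_fibers_dense R _ _ HB (fun f => f ord_max)) => //.
  - by move=> f /setIdP[/boxP fB _]; rewrite -Bmax.
  - move=> t; rewrite ler_nat -[PB](card_box_fupd_max B t) subset_leq_card //.
    apply/subsetP => f /setIdP[/setIdP[/boxP fB _] /eqP ft]; apply/boxP => j.
    by rewrite /fupd; case: eqP => [->|_]; rewrite ?inE ?ft.
  - move: dB; rewrite card_box big_ord_recr natrM /= -/PB Bmax.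
    by rewrite mulrA.
pose A2 := fupd A' ord_max last.
have A2w i : A2 (w i) = A' (w i) by rewrite /A2 fupd_neq // widen_ord_neq_max.
exists A2; split.
- move=> j; have [->|[i ->]] := ord_widen_or_max j.
    by rewrite /A2 fupd_same; apply/subsetP => t /setIdP[].
  rewrite -/w A2w; have [A'B _ _] := small (w i) (ltn_ord i).
  exact: subset_trans A'B (BA _).
- move=> j; have [->|[i ->]] := ord_widen_or_max j.
    rewrite /A2 fupd_same; apply: le_trans card_last; apply: ler_wpM2r => //.
    by rewrite /= -/(dmin n delta) -/d; move: d0; clear; lra.
  by rewrite -/w A2w; have [] := small (w i) (ltn_ord i).
move=> Q QA2.
pose P q := [set p : {ffun 'I_n -> S} * {ffun 'I_n -> S} * S |
  \sum_i (val (p.1.1 i) - val (p.1.2 i)) + val p.2 == q].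
pose M := d / 4 * PB%:R * \prod_(i < n) (threshold delta eps (w i)
  * #|A (if w i == m then ord_max else m)|%:R).
have PM q : q \in Q -> M <= #|P q|%:R.
  move=> /QA2[a aA2 ->]; apply: (@card_representations R G S n T phi A B A2 H) => //.
    by move=> i b; rewrite A2w; exact: (bad (w i) (ltn_ord i)).
  by have /boxP/(_ ord_max) := aA2; rewrite /A2 fupd_same => /setIdP[].
have sumP : (\sum_(q : Q) #|P (val q)| <= #|` S| ^ (2 * n).+1)%N.
  have -> : (\sum_(q : Q) #|P (val q)| = \sum_(q in [set: Q])
      #|[set p in [set: {ffun 'I_n -> S} * {ffun 'I_n -> S} * S] |
          p \in P (val q)]|)%N.
    apply: eq_big => [q|q _]; first by rewrite inE.
    by apply: eq_card => p; rewrite !inE.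
  rewrite -double_counting.
  apply: (@leq_trans (\sum_(p in [set: {ffun 'I_n -> S} * {ffun 'I_n -> S} * S]) 1)).
    apply: leq_sum => p _; apply/card_le1_eqP => q q'.
    by rewrite !inE => /eqP qE /eqP q'E; apply: val_inj; rewrite -qE -q'E.
  rewrite sum1_card cardsT !card_prod !card_ffun card_ord -cardfE.
  by rewrite -expnD -expnSr addnn -mul2n.
have MQ : M * #|` Q|%:R <= #|` S|%:R ^+ (2 * n).+1.
  apply: (@le_trans _ _ (\sum_(q : Q) #|P (val q)|)%:R); last first.
    by rewrite -natrX ler_nat.
  rewrite natr_sum cardfE mulr_natr -sumr_const.
  by apply: ler_sum => q _; apply: PM; exact: valP.
have PB_ge : (d / 4) ^+ n * \prod_(i < n) #|A (w i)|%:R <= PB%:R.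
  rewrite natr_prod -[n in _ ^+ n]card_ord -prodr_const -big_split /=.
  apply: ler_prod => i _; rewrite B_ge andbT mulr_ge0 //.
  by rewrite ltW // dmin4_gt0.
set X := \prod_i #|A i|%:R * _.
(* The powers of [d] are 1 from the link, [n] from the sizes of the [B i], [3 * n] from
   [eps * d ^+ 2], and [n - 1] from the later thresholds: [5 * n] in all. *)
have M_ge : d ^+ (5 * n) * X <= 2 ^+ (10 * n) * n%:R ^+ n * M.
  pose Aw : R := \prod_(i < n) #|A (w i)|%:R.
  pose L : R := \prod_(i < n) #|A (if w i == m then ord_max else m)|%:R.
  have L0 : 0 <= L by apply: prodr_ge0.
  have ed0 : 0 <= (eps * d ^+ 2 / 8) ^+ n * (d / 4) ^+ n.-1.
    rewrite mulr_ge0 // exprn_ge0 // ltW //; last exact: dmin4_gt0.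
    by rewrite divr_gt0 // mulr_gt0 // exprn_gt0.
  have d40 : 0 <= d / 4 by rewrite ltW // dmin4_gt0.
  have XE : X = Aw * L.
    by rewrite /X -(prod_widen_other (fun i => #|A i|%:R) m n0).
  rewrite /M big_split /= prod_threshold // -/d -/L XE.
  apply: (@le_trans _ _ (2 ^+ (10 * n) * n%:R ^+ n * (d / 4 * ((d / 4) ^+ n * Aw)
      * ((eps * d ^+ 2 / 8) ^+ n * (d / 4) ^+ n.-1 * L)))); last first.
    apply: ler_wpM2l; first by rewrite mulr_ge0 ?exprn_ge0.
    apply: ler_wpM2r; first by rewrite mulr_ge0.
    exact: ler_wpM2l.
  rewrite le_eqVlt; apply/orP; left; apply/eqP.
  have -> : d ^+ (5 * n)
      = (2 ^+ 10 * n%:R * (d / 4) * (d / 4) * (eps * d ^+ 2 / 8)) ^+ n.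
    rewrite exprM; congr (_ ^+ n); rewrite /eps; field.
    by rewrite pnatr_eq0 -lt0n.
  have dn : (d / 4) ^+ n = d / 4 * (d / 4) ^+ n.-1 by rewrite -exprS prednK.
  move: (d / 4) (eps * d ^+ 2 / 8) dn => x e xn.
  rewrite (exprM 2 10 n) !exprMn xn; ring.
have n0' : 0 <= 2 ^+ (10 * n) * n%:R ^+ n :> R by rewrite mulr_ge0 ?exprn_ge0.
apply: (@le_trans _ _ (2 ^+ (10 * n) * n%:R ^+ n * M * #|` Q|%:R)).
  by apply: ler_wpM2r.
by rewrite -mulrA; apply: ler_wpM2l.
Qed.

(** * Transfer to finite subsets of the group *)

Lemma restricted_sumset_fset (R : realFieldType) (G : zmodType) (n : nat)
    (A : 'I_n.+1 -> {fset G}) (H : {fset {ffun 'I_n.+1 -> G}}) (delta : R)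
    (m : 'I_n.+1) :
  (0 < n)%N -> 0 < delta -> (forall i, A i != fset0) -> H `<=` cartprod A ->
  delta * \prod_i #|` A i|%:R <= #|` H|%:R ->
  delta <= 1 /\ exists A' : 'I_n.+1 -> {fset G},
    [/\ forall i, A' i `<=` A i,
        forall i : 'I_n.+1, delta / 2 ^+ i / 8 * #|` A i|%:R <= #|` A' i|%:R
      & dmin n delta ^+ (5 * n) * (\prod_i #|` A i|%:R * #|` A m|%:R ^+ n.-1)
          * #|` sumset A'|%:R
        <= 2 ^+ (10 * n) * n%:R ^+ n * #|` hsum H|%:R ^+ (2 * n).+1].
Proof.
move=> n0 delta0 A0 HA dense.
(* The union of the parts is one finite type carrying all of them; [val] is the injection into the
   group. *)
pose U := (\bigcup_(i <- enum 'I_n.+1) A i)%fset.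
have AU i : A i `<=` U by apply: bigfcup_sup; rewrite ?mem_enum.
pose As i : {set U} := fsub U (A i).
have cAs i : #|As i| = #|` A i| by exact: card_fsub.
pose lower (f : {ffun 'I_n.+1 -> U}) : {ffun 'I_n.+1 -> G} := [ffun i => val (f i)].
pose Hs : {set {ffun 'I_n.+1 -> U}} := [set f | lower f \in H].
have cbox : #|box As|%:R = \prod_i #|` A i|%:R :> R.
  by rewrite card_box natr_prod; apply: eq_bigr => i _; rewrite cAs.
have cH : (#|` H| <= #|[set f in box As | f \in Hs]|)%N.
  have sub : H `<=` [fset lower f | f in [set f in box As | f \in Hs]].
    apply/fsubsetP => h hH; have /cartprodP hA := fsubsetP HA _ hH.
    pose f : {ffun 'I_n.+1 -> U} := [ffun i => FSetSub (fsubsetP (AU i) _ (hA i))].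
    have fh : lower f = h by apply/ffunP => i; rewrite !ffunE.
    apply/imfsetP; exists f => //=; apply/setIdP.
    by split; [apply/boxP => i; rewrite in_fsub ffunE; exact: hA | rewrite inE fh].
  apply: leq_trans (fsubset_leq_card sub) _.
  by apply: leq_trans (leq_imfset_card _ _ _) _; rewrite /= -cardE.
have dense' : delta * #|box As|%:R <= #|[set f in box As | f \in Hs]|%:R.
  by rewrite cbox; apply: le_trans dense _; rewrite ler_nat.
have As0 i : (0 < #|As i|)%N by rewrite cAs cardfs_gt0.
have delta1 : delta <= 1.
  have b0 : 0 < #|box As|%:R :> R by rewrite ltr0n card_box prodn_gt0.
  rewrite -(ler_pM2r b0) mul1r; apply: le_trans dense' _.
  by rewrite ler_nat subset_leq_card //; apply/subsetP => f /setIdP[].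
split=> //.
have sumHs : {in Hs, forall f : {ffun 'I_n.+1 -> U}, \sum_i val (f i) \in hsum H}.
  move=> f; rewrite inE => fH; apply/imfsetP; exists (lower f) => //.
  by apply: eq_bigr => i _; rewrite ffunE.
have [A' [A'A cA' sumA']] :=
  restricted_sumset m val_inj sumHs n0 delta0 delta1 As0 dense'.
pose A'G i := [fset val t | t in A' i].
exists A'G; split.
- move=> i; apply/fsubsetP => x /imfsetP[t /= tA' ->].
  by have := subsetP (A'A i) _ tA'; rewrite in_fsub.
- move=> i; have := cA' i; rewrite cAs => /le_trans; apply.
  by rewrite card_imfset //=; [rewrite -cardE | exact: val_inj].
have -> : \prod_i #|` A i|%:R = \prod_i #|As i|%:R :> R.
  by apply: eq_bigr => i _; rewrite cAs.
rewrite -cAs; apply: sumA' => q /imfsetP[a /= /cartprodP aA' ->].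
have /fin_all_exists2[f fA' fa] i : exists2 t, t \in A' i & val t = a i.
  by have /imfsetP[t /= tA' ->] := aA' i; exists t.
exists (finfun f); first by apply/boxP => i; rewrite ffunE.
by apply: eq_bigr => i _; rewrite ffunE fa.
Qed.

(** * Choice of the reference part and final constants *)

Lemma prod_le_max_exp (R : realFieldType) n (x : 'I_n.+1 -> nat) :
  exists m, (\prod_i (x i)%:R <= (x m)%:R ^+ n.+1 :> R).
Proof.
exists [arg max_(i > ord0) x i]; case: arg_maxnP => //= m _ xm.
rewrite -[n.+1 in X in _ <= X]card_ord -prodr_const.
by apply: ler_prod => i _; rewrite ler0n ler_nat; exact: xm.
Qed.

Theorem theorem1p4 (R : realType) (r : nat) (hr : (2 <= r)%N)
    (K C : R) (hK : 0 < K) (hC : 0 < C)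
    (G : zmodType) (A : 'I_r -> {fset G}) (hA : forall i, A i != fset0)
    (H : {fset {ffun 'I_r -> G}}) (hHA : H `<=` cartprod A)
    (hH : (#|` H|)%:R >= 1 / K * \prod_(i < r) (#|` A i|)%:R)
    (hsumH : (#|` hsum H|)%:R <=
       C * (\prod_(i < r) (#|` A i|)%:R) `^ (1 / r%:R)) :
  exists A' : 'I_r -> {fset G},
    [/\ forall i, A' i `<=` A i,
        (* i is 0-based, hence i.+1 in the exponent *)
        forall i, (#|` A' i|)%:R >= (#|` A i|)%:R / (2 ^+ (i.+1 + 2) * K)
      & (#|` sumset A'|)%:R <=
          8 ^+ (r ^ 3) * (r%:R - 1) ^+ (r - 1)
          * K `^ ((r%:R ^+ 2 + 5 * r%:R - 4) / 2) * C ^+ (2 * r - 1)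
          * (\prod_(i < r) (#|` A i|)%:R) `^ (1 / r%:R)].
Proof.
case: r hr A hA H hHA hH hsumH => [//|n] n0 A hA H hHA hH hsumH.
rewrite ltnS in n0.
(* With [r = n + 1], the largest part [m] has size at least the geometric mean [N]. *)
have [m Pm] := prod_le_max_exp R (fun i => #|` A i|).
have K0 : 0 < 1 / K by rewrite divr_gt0.
have [K1 [A' [A'A cA' sumA']]] := restricted_sumset_fset m n0 K0 hA hHA hH.
have {}K1 : 1 <= K by rewrite ler_pdivrMr ?mul1r in K1.
exists A'; split=> //.
  move=> i; apply: le_trans (cA' i); rewrite addnC !exprS.
  rewrite le_eqVlt; apply/orP; left; apply/eqP; field.
  by rewrite !gt_eqF ?exprn_gt0.
move: hsumH sumA' Pm; set P := \prod_(i < _) _; set N := P `^ _.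
set Q := #|` sumset A'|%:R; set S := #|` hsum H|%:R; set y := #|` A m|%:R.
move=> SN sumA' Pm.
have P0 : 0 < P by apply: prodr_gt0 => i _; rewrite ltr0n cardfs_gt0.
have N0 : 0 < N by exact: powR_gt0.
have NP : N ^+ n.+1 = P.
  by rewrite -powR_mulrn ?ltW // -powRrM mul1r mulVf ?pnatr_eq0 // powRr1 // ltW.
have Ny : N <= y.
  by rewrite -(@ler_pXn2r _ n.+1) ?nnegrE ?ler0n ?NP // ltW.
have d0 : 0 < dmin n (1 / K) by exact: dmin_gt0.
(* Here [P * y ^+ n.-1 >= N ^+ (2 * n)] and [S <= C * N], so cancelling [N ^+ (2 * n)] leaves one
   factor [N]. *)
have dQ : dmin n (1 / K) ^+ (5 * n) * Q
    <= 2 ^+ (10 * n) * n%:R ^+ n * C ^+ (2 * n).+1 * N.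
  have Nn0 : 0 < N ^+ (2 * n) by rewrite exprn_gt0.
  rewrite -(ler_pM2r Nn0).
  apply: (@le_trans _ _ (dmin n (1 / K) ^+ (5 * n) * (P * y ^+ n.-1) * Q)).
    rewrite mulrAC; apply: ler_wpM2r; first exact: ler0n.
    apply: ler_wpM2l; first by rewrite exprn_ge0 // ltW.
    have -> : (2 * n = n.+1 + n.-1)%N by clear -n0; lia.
    rewrite exprD NP; apply: ler_wpM2l; first exact: ltW.
    by rewrite lerXn2r // nnegrE ltW // (lt_le_trans N0).
  apply: le_trans sumA' _.
  have -> : 2 ^+ (10 * n) * n%:R ^+ n * C ^+ (2 * n).+1 * N * N ^+ (2 * n)
      = 2 ^+ (10 * n) * n%:R ^+ n * (C * N) ^+ (2 * n).+1.
    by rewrite exprMn [N ^+ (2 * n).+1]exprS; ring.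
  apply: ler_wpM2l; first by rewrite mulr_ge0 ?exprn_ge0.
  by rewrite lerXn2r // nnegrE ?ler0n // mulr_ge0 // ltW.
have dE : dmin n (1 / K) ^+ (5 * n) * (K ^+ (5 * n) * 2 ^+ (n * (5 * n))) = 1.
  rewrite [2 ^+ (n * _)]exprM -!exprMn /dmin -[RHS](expr1n _ (5 * n)).
  congr (_ ^+ _); field.
  by rewrite !gt_eqF ?exprn_gt0.
have {dQ} Qle : Q <= 2 ^+ (10 * n + n * (5 * n)) * n%:R ^+ n * K ^+ (5 * n)
    * C ^+ (2 * n).+1 * N.
  have KK0 : 0 <= K ^+ (5 * n) * 2 ^+ (n * (5 * n)).
    by rewrite mulr_ge0 ?exprn_ge0 // ltW.
  have := ler_wpM2r KK0 dQ; rewrite mulrAC dE mul1r => /le_trans; apply.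
  by rewrite exprD le_eqVlt; apply/orP; left; apply/eqP; ring.
apply: (le_trans Qle); rewrite subn1 /= -[in n.+1%:R - 1]natr1 addrK.
have -> : (2 * n.+1 - 1 = (2 * n).+1)%N by clear; lia.
apply: ler_wpM2r; first exact: ltW.
apply: ler_wpM2r; first by rewrite exprn_ge0 // ltW.
have c8 : 2 ^+ (10 * n + n * (5 * n)) <= 8 ^+ (n.+1 ^ 3) :> R.
  have -> : 8 = 2 ^+ 3 :> R by ring.
  by rewrite -exprM ler_weXn2l ?ler1n //; clear -n0; nia.
apply: ler_pM.
- by rewrite mulr_ge0 ?exprn_ge0.
- by rewrite exprn_ge0 // ltW.
- by apply: ler_wpM2r => //; rewrite exprn_ge0.
rewrite -(powR_mulrn (5 * n) (ltW hK)); apply: ler_powR => //.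
(* The target exponent of [K] is [(n ^ 2 + 7 * n + 2) / 2]; it is at least [5 * n] because
   [(n - 1) * (n - 2) >= 0] for integers. Since [K >= 1], comparing exponents suffices. *)
have : (3 * n <= n * n + 2)%N.
  by clear -n0; case: n n0 => [|[|[|k]]] // _; nia.
rewrite -(ler_nat R) !natrD !natrM -(natr1 n); lra.
Qed.
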